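(* Let $Z_1,\dots,Z_n$ be i.i.d. with distribution $Q$ on a measurable space $\mathcal Z$ and $\psi:\mathcal Z\to\mathbb R^d$ measurable with $\int\|\psi\|^2dQ<\infty$. Let $m\ge1$ be fixed and, for each $n$, let $T_{n1},\dots,T_{nn}$ be $m$-dimensional random vectors. With $T_n^*=\max_j\|T_{nj}\|$, $\bar T_n=\frac1n\sum_jT_{nj}$, $\mathbb S_n=\frac1n\sum_jT_{nj}T_{nj}^\top$, $A_n=\frac1n\sum_jE(\psi(Z_j)T_{nj}^\top)$, assume: $T_n^*=o_p(n^{1/2})$; $\|\bar T_n\|=O_p(n^{-1/2})$; there is a regular sequence of $m\times m$ dispersion matrices $W_n$ with $|\mathbb S_n-W_n|_o=o_p(1)$; $\frac1n\sum_j\big(\psi(Z_j)T_{nj}^\top-E[\psi(Z_j)T_{nj}^\top]\big)=o_p(1)$; and there is a measurable $\chi:\mathcal Z\to\mathbb R^d$ with $\int\chi\,dQ=0$, $\int\|\chi\|^2dQ<\infty$ and $\frac1n\sum_i\big(A_nW_n^{-1}T_{ni}-\chi(Z_i)\big)=o_p(n^{-1/2})$. Then, on an event whose probability tends to one as $n\to\infty$, there is a unique $\zeta_n\in\mathbb R^m$ with $1+\zeta_n^\top T_{nj}>0$ for all $j$ and $\frac1n\sum_jT_{nj}/(1+\zeta_n^\top T_{nj})=0$, and $$\frac1n\sum_{j=1}^n\frac{\psi(Z_j)}{1+\zeta_n^\top T_{nj}}=\bar\psi-\bar\chi+o_p(n^{-1/2}),$$ with $\bar\psi=\frac1n\sum_j\psi(Z_j)$,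 $\bar\chi=\frac1n\sum_j\chi(Z_j)$.
   Context: A sequence of $m\times m$ dispersion matrices $W_n$ is regular if $0<\inf_n\inf_{\|a\|=1}a^\top W_na\le\sup_n\sup_{\|a\|=1}a^\top W_na<\infty$ (for $W_n=W$ constant this is nonsingularity). $|A|_o$ denotes the spectral (operator) norm. *)

(* Defs.v *)
From HB Require Import structures.
From mathcomp Require Import all_boot all_order all_algebra.
From mathcomp Require Import all_classical all_reals all_analysis.
Set Implicit Arguments. Unset Strict Implicit. Unset Printing Implicit Defensive.
Import Order.TTheory GRing.Theory Num.Theory.
Import numFieldNormedType.Exports.
Local Open Scope classical_set_scope.
Local Open Scope ring_scope.

Section Defs.
Variable R : realType.

Definition fnorm (p q : nat) (A : 'M[R]_(p, q)) : R :=
  Num.sqrt (\sum_(i < p) \sum_(j < q) A i j ^+ 2).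

Definition vnorm (p : nat) (v : 'cV[R]_p) : R := fnorm v.

Definition opnorm (p q : nat) (A : 'M[R]_(p, q)) : R :=
  sup [set vnorm (A *m a) | a in [set a : 'cV[R]_q | vnorm a = 1]].

Definition qform (p : nat) (a : 'cV[R]_p) (M : 'M[R]_p) (b : 'cV[R]_p) : R :=
  ((a^T *m M *m b) 0 0).

Definition regular_dispersion (p : nat) (W : nat -> 'M[R]_p) : Prop :=
  (forall n, (W n)^T = W n) /\
  exists c C : R, 0 < c /\ forall n (a : 'cV[R]_p), vnorm a = 1 ->
     c <= qform a (W n) a <= C.

Variables (d : measure_display) (Omega : measurableType d).
Variable (P : probability Omega R).

Definition outer_prob_to0 (A : nat -> set Omega) : Prop :=
  forall e : R, 0 < e -> \forall n \near \oo,
    exists B : set Omega, [/\ measurable B, A n `<=` B & P B <= e%:E]%E.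

Definition little_op (X : nat -> Omega -> R) (r : nat -> R) : Prop :=
  forall eps : R, 0 < eps ->
    outer_prob_to0 (fun n => [set w | eps * r n < `|X n w|]).

Definition big_Op (X : nat -> Omega -> R) (r : nat -> R) : Prop :=
  forall eps : R, 0 < eps -> exists M : R, 0 < M /\ \forall n \near \oo,
    exists B : set Omega,
      [/\ measurable B, [set w | M * r n < `|X n w|] `<=` B & (P B <= eps%:E)%E].

Variables (dz : measure_display) (Z : measurableType dz).

Definition mutually_independent (X : nat -> Omega -> Z) : Prop :=
  forall (k : nat) (idx : 'I_k -> nat) (B : 'I_k -> set Z),
    injective idx -> (forall i, measurable (B i)) ->
    P [set w | forall i, B i (X (idx i) w)] =
      (\prod_(i < k) fine (P (X (idx i) @^-1` B i)))%:E.

Definition iid (Q : probability Z R) (X : nat -> Omega -> Z) : Prop :=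
  [/\ forall i, measurable_fun setT (X i),
      forall i (B : set Z), measurable B -> P (X i @^-1` B) = Q B
    & mutually_independent X].

Definition Emx (p q : nat) (M : Omega -> 'M[R]_(p, q)) : 'M[R]_(p, q) :=
  \matrix_(i, j) fine (\int[P]_w (M w i j)%:E)%E.

End Defs.

(* Main.v *)
(* The multiplier is found as a fixed point of z |-> z + g z / (4b), where g is the
   empirical score: a difference g z - g z' equals minus a weighted Gram operator of
   the T_j applied to z - z', so this map contracts the ball of radius
   O(|mean T|), on which all 1 + z.T_j stay in [1/2, 2]. The same identity gives
   uniqueness among all admissible z. Expanding 1/(1+x) = 1 - x + x^2/(1+x) twice,
   once for T (which yields z = W^-1 mean T + o(n^-1/2)) and once for psi, bounds the
   error for each fixed outcome by an explicit expression in max |T_j|, |mean T|,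
   |S - W|, |M - A| (M the mean of psi T^T), the chi-remainder and the mean of
   |psi|^2, the last being O_p(1) by Markov's inequality. *)
Require Import Defs.
From HB Require Import structures.
From mathcomp Require Import all_boot all_order all_algebra.
From mathcomp Require Import all_classical all_reals all_analysis.
From mathcomp Require Import measurable_realfun ring lra.
Set Implicit Arguments. Unset Strict Implicit. Unset Printing Implicit Defensive.
Import Order.TTheory GRing.Theory Num.Theory.
Import numFieldNormedType.Exports.
Local Open Scope classical_set_scope.
Local Open Scope ring_scope.

(** * Cauchy-Schwarz inequalities for finite sums *)

Lemma weighted_cauchy_schwarz (R : realType) (I : finType) (w a b : I -> R) :
  (forall i, 0 <= w i) ->
  (\sum_i w i * (a i * b i)) ^+ 2 <=
  (\sum_i w i * a i ^+ 2) * (\sum_i w i * b i ^+ 2).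
Proof.
move=> w0.
(* Lagrange's identity: this nonnegative double sum is twice the gap between the two sides. *)
have : 0 <= \sum_i \sum_j w i * w j * (a i * b j - a j * b i) ^+ 2.
  apply: sumr_ge0 => i _; apply: sumr_ge0 => j _.
  by rewrite mulr_ge0 ?sqr_ge0// mulr_ge0.
set A := \sum_i w i * a i ^+ 2; set B := \sum_i w i * b i ^+ 2.
set C := \sum_i w i * (a i * b i).
suff -> : \sum_i \sum_j w i * w j * (a i * b j - a j * b i) ^+ 2 =
    (A * B - C ^+ 2) *+ 2 by rewrite pmulrn_lge0// subr_ge0.
have -> : (A * B - C ^+ 2) *+ 2 = A * B + B * A - C * C *+ 2 by ring.
rewrite /A /B /C !big_distrlr /= -sumrMnl -big_split -sumrB /=.
apply: eq_bigr => i _; rewrite -sumrMnl -big_split -sumrB /=.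
by apply: eq_bigr => j _; ring.
Qed.

Lemma cauchy_schwarz (R : realType) (I : finType) (a b : I -> R) :
  (\sum_i a i * b i) ^+ 2 <= (\sum_i a i ^+ 2) * (\sum_i b i ^+ 2).
Proof.
have := @weighted_cauchy_schwarz R I (fun=> 1) a b (fun=> ler01).
have E (F : I -> R) : \sum_i 1 * F i = \sum_i F i.
  by apply: eq_bigr => i _; rewrite mul1r.
by rewrite !E.
Qed.

(** * The Frobenius norm and the inner product of column vectors *)

Section Frobenius.
Context {R : realType}.

Lemma fnorm_ge0 p q (A : 'M[R]_(p, q)) : 0 <= fnorm A.
Proof. exact: sqrtr_ge0. Qed.

Lemma sqr_fnorm p q (A : 'M[R]_(p, q)) :
  fnorm A ^+ 2 = \sum_i \sum_j A i j ^+ 2.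
Proof.
by rewrite sqr_sqrtr// sumr_ge0// => i _; rewrite sumr_ge0// => j _; rewrite sqr_ge0.
Qed.

Lemma fnorm_trmx p q (A : 'M[R]_(p, q)) : fnorm A^T = fnorm A.
Proof.
rewrite /fnorm exchange_big; congr Num.sqrt.
by apply: eq_bigr => i _; apply: eq_bigr => j _; rewrite mxE.
Qed.

Lemma fnormZ p q (k : R) (A : 'M[R]_(p, q)) : fnorm (k *: A) = `|k| * fnorm A.
Proof.
apply/eqP; rewrite -(@eqrXn2 _ 2) ?mulr_ge0 ?fnorm_ge0//.
rewrite exprMn real_normK ?num_real// !sqr_fnorm mulr_sumr; apply/eqP.
apply: eq_bigr => i _; rewrite mulr_sumr; apply: eq_bigr => j _.
by rewrite mxE exprMn.
Qed.

Lemma fnormN p q (A : 'M[R]_(p, q)) : fnorm (- A) = fnorm A.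
Proof. by rewrite -scaleN1r fnormZ normrN1 mul1r. Qed.

Lemma fnorm0 p q : fnorm (0 : 'M[R]_(p, q)) = 0.
Proof. by rewrite -[0](scale0r (0 : 'M[R]_(p, q))) fnormZ normr0 mul0r. Qed.

Lemma le_fnormD p q (A B : 'M[R]_(p, q)) : fnorm (A + B) <= fnorm A + fnorm B.
Proof.
rewrite -(@ler_pXn2r _ 2) ?nnegrE ?addr_ge0 ?fnorm_ge0// sqrrD.
have E : fnorm (A + B) ^+ 2 = fnorm A ^+ 2 +
    (\sum_i \sum_j A i j * B i j) *+ 2 + fnorm B ^+ 2.
  rewrite !sqr_fnorm -sumrMnl -!big_split /=; apply: eq_bigr => i _.
  rewrite -sumrMnl -!big_split /=; apply: eq_bigr => j _.
  by rewrite mxE; ring.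
rewrite E lerD2r lerD2l lerMn2r /=.
apply: (le_trans (ler_norm _)).
rewrite -(@ler_pXn2r _ 2) ?nnegrE ?mulr_ge0 ?fnorm_ge0//.
rewrite real_normK ?num_real// exprMn !sqr_fnorm !pair_big /=.
exact: cauchy_schwarz.
Qed.

Lemma le_fnormB p q (A B : 'M[R]_(p, q)) : fnorm (A - B) <= fnorm A + fnorm B.
Proof. by rewrite -[fnorm B]fnormN le_fnormD. Qed.

Lemma le_fnorm_sum p q (I : finType) (F : I -> 'M[R]_(p, q)) :
  fnorm (\sum_i F i) <= \sum_i fnorm (F i).
Proof.
elim/big_rec2: _ => [|i y x _ le_xy]; first by rewrite fnorm0.
by apply: (le_trans (le_fnormD _ _)); rewrite lerD2l.
Qed.

Lemma le_fnormM p q r (A : 'M[R]_(p, q)) (B : 'M[R]_(q, r)) :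
  fnorm (A *m B) <= fnorm A * fnorm B.
Proof.
rewrite -(@ler_pXn2r _ 2) ?nnegrE ?mulr_ge0 ?fnorm_ge0//.
rewrite exprMn !sqr_fnorm mulr_suml; apply: ler_sum => i _.
rewrite exchange_big mulr_sumr; apply: ler_sum => k _.
by rewrite mxE; exact: cauchy_schwarz.
Qed.

Lemma fnorm_eq0 p q (A : 'M[R]_(p, q)) : fnorm A = 0 -> A = 0.
Proof.
move=> /(congr1 (fun x => x ^+ 2)); rewrite expr0n sqr_fnorm /= => /eqP.
rewrite psumr_eq0; last by move=> i _; apply: sumr_ge0 => j _; exact: sqr_ge0.
move=> /allP A0; apply/matrixP => i j; rewrite mxE.
have := A0 i (mem_index_enum i); rewrite psumr_eq0 => [|k _]; last exact: sqr_ge0.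
by move=> /allP /(_ j (mem_index_enum j)); rewrite sqrf_eq0 => /eqP.
Qed.

Lemma norm_coef_le_fnorm p q (A : 'M[R]_(p, q)) i j : `|A i j| <= fnorm A.
Proof.
rewrite -(@ler_pXn2r _ 2) ?nnegrE ?fnorm_ge0// real_normK ?num_real// sqr_fnorm.
rewrite (bigD1 i)//= (bigD1 j)//= -addrA lerDl addr_ge0//.
  by apply: sumr_ge0 => k _; exact: sqr_ge0.
by apply: sumr_ge0 => k _; apply: sumr_ge0 => l _; exact: sqr_ge0.
Qed.

(** Kept in the matrix form used by the theorem's statement, so that the admissibility conditions
    agree with it by conversion. *)
Definition dot p (u v : 'cV[R]_p) : R := (u^T *m v) 0 0.

Lemma dotE p (u v : 'cV[R]_p) : dot u v = \sum_i u i 0 * v i 0.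
Proof. by rewrite /dot mxE; apply: eq_bigr => i _; rewrite mxE. Qed.

Lemma dotC p (u v : 'cV[R]_p) : dot u v = dot v u.
Proof. by rewrite !dotE; apply: eq_bigr => i _; rewrite mulrC. Qed.

Lemma dotDr p (u v w : 'cV[R]_p) : dot u (v + w) = dot u v + dot u w.
Proof. by rewrite /dot mulmxDr mxE. Qed.

Lemma dotZr p k (u v : 'cV[R]_p) : dot u (k *: v) = k * dot u v.
Proof. by rewrite /dot -scalemxAr mxE. Qed.

Lemma dotNr p (u v : 'cV[R]_p) : dot u (- v) = - dot u v.
Proof. by rewrite -scaleN1r dotZr mulN1r. Qed.

Lemma dotBr p (u v w : 'cV[R]_p) : dot u (v - w) = dot u v - dot u w.
Proof. by rewrite dotDr dotNr. Qed.

Lemma dotBl p (u v w : 'cV[R]_p) : dot (u - v) w = dot u w - dot v w.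
Proof. by rewrite ![dot _ w]dotC dotBr. Qed.

Lemma dotZl p k (u v : 'cV[R]_p) : dot (k *: u) v = k * dot u v.
Proof. by rewrite dotC dotZr dotC. Qed.

Lemma dot_sumr p (I : finType) (u : 'cV[R]_p) (F : I -> 'cV[R]_p) :
  dot u (\sum_i F i) = \sum_i dot u (F i).
Proof. by rewrite /dot mulmx_sumr summxE. Qed.

Lemma dot0l p (v : 'cV[R]_p) : dot 0 v = 0.
Proof. by rewrite /dot trmx0 mul0mx mxE. Qed.

Lemma dotvv p (v : 'cV[R]_p) : dot v v = fnorm v ^+ 2.
Proof.
rewrite dotE sqr_fnorm; apply: eq_bigr => i _.
by rewrite big_ord1 expr2.
Qed.

Lemma norm_dot_le p (u v : 'cV[R]_p) : `|dot u v| <= fnorm u * fnorm v.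
Proof.
rewrite -(fnorm_trmx u).
by apply: (le_trans (norm_coef_le_fnorm _ _ _)); exact: le_fnormM.
Qed.

Lemma sqr_fnormB p (u v : 'cV[R]_p) :
  fnorm (u - v) ^+ 2 = fnorm u ^+ 2 - dot u v *+ 2 + fnorm v ^+ 2.
Proof.
by rewrite -!dotvv dotBl !dotBr (dotC v u); ring.
Qed.

End Frobenius.

(** * Fixed points of contractions of a closed ball *)

Section FixedPoint.
Context {R : realType}.

Lemma fnorm_continuous p q : continuous (@fnorm R p q).
Proof.
move=> A.
apply: (@continuous_comp _ _ _ (fun B : 'M[R]_(p, q) => \sum_i \sum_j B i j ^+ 2)
  (@Num.sqrt R)); last exact: sqrt_continuous.
apply: continuous_big => [|i _]; first exact: add_continuous.
apply: continuous_big => [|j _]; first exact: add_continuous.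
move=> {}A; apply: (@continuous_comp _ _ _ (fun B : 'M[R]_(p, q) => B i j)
  (fun x : R => x ^+ 2)); first exact: coord_continuous.
exact: exprn_continuous.
Qed.

(** Row vectors are used because [EVT_min_rV] is about them. The library norm is the largest
    absolute entry, which [fnorm] dominates, so the ball is bounded; it is closed by continuity of
    [fnorm]. *)
Lemma compact_fnorm_ball n (r : R) : compact [set x : 'rV[R]_n | fnorm x <= r].
Proof.
apply: bounded_closed_compact.
  exists r; split; first exact: num_real.
  move=> M rM x /= xr; apply: (le_trans _ (ltW (le_lt_trans xr rM))).
  rewrite [leLHS]mx_normrE; apply: bigmax_le => [|i _]; first exact: fnorm_ge0.
  exact: norm_coef_le_fnorm.
have -> : [set x : 'rV[R]_n | fnorm x <= r] = (@fnorm R 1 n) @^-1` [set y | y <= r].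
  by [].
apply: closed_comp; last exact: closed_le.
by move=> x _; exact: fnorm_continuous.
Qed.

(* By compactness the displacement is minimal at some point, where it must
   vanish since applying the map decreases it. *)
Lemma ball_fixpoint m (r q : R) (Phi : 'cV[R]_m -> 'cV[R]_m) :
  0 <= r -> 0 <= q < 1 ->
  (forall x, fnorm x <= r -> fnorm (Phi x) <= r) ->
  (forall x y, fnorm x <= r -> fnorm y <= r ->
     fnorm (Phi x - Phi y) <= q * fnorm (x - y)) ->
  exists x, fnorm x <= r /\ Phi x = x.
Proof.
move=> r0 /andP[q0 q1] Phir Phiq.
pose g (x : 'rV[R]_m) := fnorm (Phi x^T - x^T).
pose A := [set x : 'rV[R]_m | fnorm x <= r].
have Phir' x y : A x -> A y -> fnorm (Phi x^T - Phi y^T) <= fnorm (x - y).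
  move=> Ax Ay; rewrite -(fnorm_trmx (x - y)) raddfB.
  apply: (le_trans (Phiq _ _ _ _)); rewrite ?fnorm_trmx//.
  by apply: ler_piMl; rewrite ?fnorm_ge0// ltW.
have gB x y : A x -> A y -> g x - g y <= 2 * fnorm (x - y).
  move=> Ax Ay; rewrite lerBlDr /g.
  have -> : Phi x^T - x^T = (Phi x^T - Phi y^T) - (x - y)^T + (Phi y^T - y^T).
    by rewrite raddfB/=; apply/matrixP => i j; rewrite !mxE; ring.
  apply: (le_trans (le_fnormD _ _)); rewrite lerD2r.
  apply: (le_trans (le_fnormB _ _)); rewrite fnorm_trmx.
  by have := Phir' x y Ax Ay; lra.
have cg : {within A, continuous g}.
  apply/subspace_continuousP => x xA; apply/cvgrPdist_lt => /= e e0.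
  have : \forall y \near x, 2 * fnorm (x - y) < e.
    have cx : 2 * fnorm (x - y) @[y --> x] --> 2 * fnorm (x - x).
      apply: (@cvgM R _ (nbhs x) _ (fun=> 2) (fun y => fnorm (x - y))).
        exact: cvg_cst.
      apply: continuous_cvg; first exact: fnorm_continuous.
      by apply: cvgB; [exact: cvg_cst|exact: cvg_id].
    by apply: (cvgr_lt _ cx); rewrite subrr fnorm0 mulr0.
  rewrite near_withinE; apply: filterS => y xy Ay.
  have := gB _ _ xA Ay; have := gB _ _ Ay xA.
  have -> : fnorm (y - x) = fnorm (x - y) by rewrite -fnormN opprB.
  by rewrite /from_subspace ltr_norml => ? ?; apply/andP; split; lra.
have [|x xA xmin] := @EVT_min_rV R m g A _ (@compact_fnorm_ball m r) cg.
  by exists 0; rewrite /A/= fnorm0.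
rewrite inE /A/= in xA.
exists x^T; rewrite fnorm_trmx; split=> //; apply/eqP; rewrite -subr_eq0.
apply/eqP; apply: fnorm_eq0.
have xr : fnorm x^T <= r by rewrite fnorm_trmx.
have := xmin (Phi x^T)^T; rewrite inE /A/= /g !trmxK fnorm_trmx => /(_ (Phir _ xr)).
have := Phiq _ _ (Phir _ xr) xr.
have := fnorm_ge0 (Phi x^T - x^T); nra.
Qed.

End FixedPoint.

(** * Weighted Gram forms, the score equation, and its unique solution *)

Section Gram.
Context {R : realType} {n m : nat}.
Implicit Types (w : 'I_n -> R) (T : 'I_n -> 'cV[R]_m) (u v z : 'cV[R]_m).

(** The bilinear form of the weighted second-moment matrix of the [T j]; [gramv] is the
    corresponding operator. *)
Definition gram w T u v : R :=
  n%:R^-1 * \sum_j w j * (dot u (T j) * dot v (T j)).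

Definition gramv w T u : 'cV[R]_m :=
  n%:R^-1 *: \sum_j (w j * dot u (T j)) *: T j.

(** The gradient at [z] of the mean of log(1 + z.T_j); its zeros are the empirical likelihood
    multipliers. *)
Definition elscore T z : 'cV[R]_m :=
  n%:R^-1 *: \sum_j (1 + dot z (T j))^-1 *: T j.

Definition eladm T z : Prop :=
  (forall j, 0 < 1 + dot z (T j)) /\ elscore T z = 0.

Lemma dot_gramv w T u v : dot v (gramv w T u) = gram w T u v.
Proof.
rewrite dotZr dot_sumr; congr (_ * _); apply: eq_bigr => j _.
by rewrite dotZr mulrA.
Qed.

Lemma le_gram w1 w2 T u :
  (forall j, w1 j <= w2 j) -> gram w1 T u u <= gram w2 T u u.
Proof.
move=> w12; apply: ler_wpM2l; first by rewrite invr_ge0.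
apply: ler_sum => j _; by rewrite ler_wpM2r// -expr2 sqr_ge0.
Qed.

Lemma gram_scale k w T u v : gram (fun j => k * w j) T u v = k * gram w T u v.
Proof.
rewrite /gram [RHS]mulrCA; congr (_ * _); rewrite mulr_sumr.
by apply: eq_bigr => j _; rewrite -mulrA.
Qed.

Lemma gram_cauchy_schwarz w T u v : (forall j, 0 <= w j) ->
  gram w T u v ^+ 2 <= gram w T u u * gram w T v v.
Proof.
move=> w0; rewrite /gram exprMn.
rewrite [leRHS](_ : _ = n%:R^-1 ^+ 2 *
  ((\sum_j w j * dot u (T j) ^+ 2) * (\sum_j w j * dot v (T j) ^+ 2))); last first.
  under eq_bigr do rewrite -expr2.
  by under [X in _ * (_ * X)]eq_bigr do rewrite -expr2; ring.
by rewrite ler_wpM2l ?sqr_ge0// weighted_cauchy_schwarz.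
Qed.

(** Write H for [gramv w T]. Expanding the square and using |Hu|^2 <= b u.Hu gives |u - Hu/b|^2 <=
    |u|^2 - u.Hu/b <= (1 - a/b)|u|^2, and 1 - a/b <= (1 - a/(2b))^2. *)
Lemma gramv_contraction w T (a b : R) : (forall j, 0 <= w j) -> 0 < a -> a <= b ->
  (forall u, a * fnorm u ^+ 2 <= gram w T u u <= b * fnorm u ^+ 2) ->
  forall u, fnorm (u - b^-1 *: gramv w T u) <= (1 - a / b / 2) * fnorm u.
Proof.
move=> w0 a0 ab gab u; have b0 : 0 < b by exact: lt_le_trans ab.
have [gau gbu] := andP (gab u); have [_ gbv] := andP (gab (gramv w T u)).
(* Cauchy-Schwarz for the form at [u] and Hu gives |Hu|^4 <= (u.Hu)(b |Hu|^2); divide by |Hu|^2 when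
   it is nonzero. *)
have HH : fnorm (gramv w T u) ^+ 2 <= b * gram w T u u.
  have := gram_cauchy_schwarz T u (gramv w T u) w0.
  rewrite -dot_gramv dotvv.
  set h := fnorm (gramv w T u) in gbv *.
  have := fnorm_ge0 (gramv w T u); rewrite -/h => h0.
  have g0 : 0 <= gram w T u u.
    by apply: (le_trans _ gau); rewrite mulr_ge0 ?sqr_ge0// ltW.
  have [->|hn0] := eqVneq h 0; first by rewrite expr0n/= mulr_ge0// ltW.
  have h2 : 0 < h ^+ 2 by rewrite exprn_gt0// lt_def hn0.
  move=> H; rewrite -(ler_pM2r h2).
  rewrite -expr2; apply: (le_trans H).
  by rewrite [leRHS](_ : _ = gram w T u u * (b * h ^+ 2)); [rewrite ler_wpM2l|ring].
have ab1 : a / b <= 1 by rewrite ler_pdivrMr// mul1r.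
have ab0 : 0 <= a / b by rewrite divr_ge0// ltW.
rewrite -(@ler_pXn2r _ 2) ?nnegrE ?mulr_ge0 ?fnorm_ge0//; last by lra.
rewrite sqr_fnormB dotZr dot_gramv fnormZ ger0_norm ?invr_ge0 ?(ltW b0)// !exprMn.
have H1 : b^-1 ^+ 2 * fnorm (gramv w T u) ^+ 2 <= b^-1 * gram w T u u.
  apply: (@le_trans _ _ (b^-1 ^+ 2 * (b * gram w T u u))).
    by rewrite ler_wpM2l ?sqr_ge0.
  by rewrite mulrA expr2 mulfVK ?gt_eqF.
have H2 : a / b * fnorm u ^+ 2 <= b^-1 * gram w T u u.
  by rewrite mulrAC mulrC ler_wpM2l ?invr_ge0 ?(ltW b0).
have H3 : 0 <= (a / b) ^+ 2 * fnorm u ^+ 2 by rewrite mulr_ge0 ?sqr_ge0.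
have -> : (1 - a / b / 2) ^+ 2 = 1 - a / b + (a / b) ^+ 2 / 4 by field; rewrite gt_eqF.
by lra.
Qed.

(** From 1/x - 1/y = (y - x)/(xy): the weights are positive on the admissible region, which drives
    both uniqueness and contraction. *)
Lemma elscoreB T z z' :
  (forall j, 0 < 1 + dot z (T j)) -> (forall j, 0 < 1 + dot z' (T j)) ->
  elscore T z - elscore T z' =
  - gramv (fun j => ((1 + dot z (T j)) * (1 + dot z' (T j)))^-1) T (z - z').
Proof.
move=> zT z'T; rewrite /elscore /gramv -scalerBr -scalerN -sumrB -sumrN.
congr (_ *: _); apply: eq_bigr => j _; rewrite -scalerBl -scaleNr; congr (_ *: _).
rewrite dotBl; field; rewrite !gt_eqF//.
Qed.

(** Pairing the score difference with z - z' gives a vanishing sum of nonnegative terms, so (z -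
    z').T_j = 0 for every j, and coercivity of the Gram form forces z = z'. *)
Lemma eladm_unique T (a : R) z z' : 0 < a ->
  (forall u, a * fnorm u ^+ 2 <= gram (fun=> 1) T u u) ->
  eladm T z -> eladm T z' -> z = z'.
Proof.
move=> a0 ga [zT sz] [z'T sz'].
have := elscoreB zT z'T; rewrite sz sz' subr0 => /(congr1 (dot (z - z'))).
rewrite dotNr dot_gramv (dotC _ 0) dot0l => /esym/eqP.
rewrite oppr_eq0 mulf_eq0 => H.
have g0 : gram (fun=> 1) T (z - z') (z - z') = 0.
  (* The factor [n%:R^-1] vanishes only for an empty sample, where the Gram form is zero anyway. *)
  case/orP: H => [n0|]; first by rewrite /gram (eqP n0) mul0r.
  rewrite psumr_eq0; last first.
    move=> j _; rewrite mulr_ge0// ?invr_ge0 -?expr2 ?sqr_ge0//.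
    by rewrite mulr_ge0// ltW.
  move=> /allP H; rewrite /gram big1 ?mulr0// => j _.
  have := H j (mem_index_enum j); rewrite /= mulf_eq0 invr_eq0 [in X in X || _]mulf_eq0.
  by rewrite (gt_eqF (zT j)) (gt_eqF (z'T j)) /= => /eqP ->; rewrite mulr0.
have := ga (z - z'); rewrite g0 => H1.
apply/eqP; rewrite -subr_eq0; apply/eqP/fnorm_eq0/eqP.
rewrite -sqrf_eq0 eq_le sqr_ge0 andbT.
by rewrite -(pmulr_rle0 _ a0).
Qed.

(** The radius is chosen so that |Phi 0| = |mean T|/(4b) equals (1 - q) r with 1 - q = a/(32b); the
    contraction then maps the ball into itself. *)
Lemma eladm_exists T (a b : R) : 0 < a -> a <= b ->
  (forall u, a * fnorm u ^+ 2 <= gram (fun=> 1) T u u <= b * fnorm u ^+ 2) ->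
  let r := 8 / a * fnorm (n%:R^-1 *: \sum_j T j) in
  (forall j, r * fnorm (T j) <= 2^-1) ->
  exists z, [/\ eladm T z, fnorm z <= r & forall j, 2^-1 <= 1 + dot z (T j)].
Proof.
move=> a0 ab gab r rT; have b0 : 0 < b by exact: lt_le_trans ab.
have r0 : 0 <= r by rewrite mulr_ge0 ?fnorm_ge0// divr_ge0// ltW.
have half z j : fnorm z <= r -> 2^-1 <= 1 + dot z (T j) <= 2.
  move=> zr; have := norm_dot_le z (T j); have := rT j.
  have : fnorm z * fnorm (T j) <= r * fnorm (T j) by rewrite ler_wpM2r ?fnorm_ge0.
  by rewrite ler_norml => ? ? /andP[? ?]; apply/andP; split; lra.
have zpos z j : fnorm z <= r -> 0 < 1 + dot z (T j).
  by move=> /half => /(_ j) /andP[+ _]; lra.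
(* On the ball each 1 + z.T_j lies in [1/2, 2], so the weights lie in [1/4, 4] and the weighted Gram
   form lies between a/4 and 4b; [q] is the resulting contraction factor. *)
pose q := 1 - (a / 4) / (4 * b) / 2.
have q_lt1 : 0 < (a / 4) / (4 * b) / 2 by rewrite !divr_gt0 ?mulr_gt0.
have q_ge0 : 0 <= q.
  have : a / b <= 1 by rewrite ler_pdivrMr// mul1r.
  by rewrite /q [(a / 4) / (4 * b)](_ : _ = a / b / 16); [lra|field; rewrite gt_eqF].
pose Phi z := z + (4 * b)^-1 *: elscore T z.
have Phiq z z' : fnorm z <= r -> fnorm z' <= r ->
    fnorm (Phi z - Phi z') <= q * fnorm (z - z').
  move=> zr z'r.
  have -> : Phi z - Phi z' =
      (z - z') + (4 * b)^-1 *: (elscore T z - elscore T z').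
    by rewrite /Phi; apply/matrixP => i j; rewrite !mxE; ring.
  rewrite elscoreB; [|by move=> j; exact: zpos..].
  rewrite scalerN; set w := (fun j => _).
  have wb j : 4^-1 * 1 <= w j <= 4 * 1.
    have /andP[h1 h2] := half z j zr; have /andP[h3 h4] := half z' j z'r.
    rewrite /w; set x := 1 + dot z _ in h1 h2 *; set y := 1 + dot z' _ in h3 h4 *.
    have xy0 : 0 < x * y by rewrite mulr_gt0//; lra.
    rewrite !mulr1; apply/andP; split.
      by rewrite lef_pV2 ?posrE//; nra.
    by rewrite invf_ple ?posrE//; nra.
  apply: gramv_contraction.
  - by move=> j; have := wb j => /andP[+ _]; lra.
  - by rewrite divr_gt0.
  - by lra.
  - move=> u; have /andP[g1 g2] := gab u.
    have W1 := @le_gram (fun=> 4^-1 * 1) w T u (fun j => proj1 (andP (wb j))).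
    have W2 := @le_gram w (fun=> 4 * 1) T u (fun j => proj2 (andP (wb j))).
    rewrite !gram_scale in W1 W2.
    by apply/andP; split; lra.
have Phir z : fnorm z <= r -> fnorm (Phi z) <= r.
  move=> zr; have z0 : fnorm (0 : 'cV[R]_m) <= r by rewrite fnorm0.
  have := Phiq _ _ zr z0; rewrite subr0 => H.
  have -> : Phi z = (Phi z - Phi 0) + Phi 0 by rewrite subrK.
  apply: (le_trans (le_fnormD _ _)).
  have -> : fnorm (Phi 0) = (4 * b)^-1 * fnorm (n%:R^-1 *: \sum_j T j).
    rewrite /Phi add0r fnormZ ger0_norm ?invr_ge0 ?mulr_ge0 ?(ltW b0)//.
    congr (_ * fnorm (_ *: _)); apply: eq_bigr => j _.
    by rewrite dot0l addr0 invr1 scale1r.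
  have : q * fnorm z <= q * r by rewrite ler_wpM2l.
  have : (4 * b)^-1 * fnorm (n%:R^-1 *: \sum_j T j) = (1 - q) * r.
    by rewrite /q /r; field; rewrite !gt_eqF.
  by lra.
have q01 : 0 <= q < 1 by rewrite q_ge0 /q; lra.
have [z [zr Phiz]] := ball_fixpoint r0 q01 Phir Phiq.
exists z; split=> //; last by move=> j; case/andP: (half z j zr).
split; first by move=> j; exact: zpos.
move: Phiz => /eqP; rewrite /Phi -subr_eq0 addrC addKr scaler_eq0 invr_eq0.
by rewrite mulf_eq0 (gt_eqF b0) pnatr_eq0 /= => /eqP.
Qed.

End Gram.

(** * Operator norm, quadratic form bounds, and inverses of coercive matrices *)

Section Operators.
Context {R : realType}.

Lemma unit_direction m (u : 'cV[R]_m) : u != 0 ->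
  exists2 v, fnorm v = 1 & u = fnorm u *: v.
Proof.
move=> u0; have nu0 : fnorm u != 0 by apply: contra_neq u0; exact: fnorm_eq0.
exists ((fnorm u)^-1 *: u); last by rewrite scalerA divff// scale1r.
by rewrite fnormZ ger0_norm ?invr_ge0 ?fnorm_ge0// mulVf.
Qed.

Lemma qformE m (u v : 'cV[R]_m) (M : 'M[R]_m) : qform u M v = dot u (M *m v).
Proof. by rewrite /qform /dot mulmxA. Qed.

Lemma opnorm_ge0 p q (A : 'M[R]_(p, q)) : 0 <= opnorm A.
Proof.
rewrite /opnorm; set E := [set _ | _ in _].
(* In dimension zero there is no unit vector, and the supremum of the empty set is 0 by
   convention. *)
have [[y Ey]|E0] := pselect (E !=set0); last first.
  suff -> : E = set0 by rewrite sup0.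
  by apply/eqP/negP => /negP/set0P.
have [a _ ay] := Ey; apply: (@le_trans _ _ y); first by rewrite -ay fnorm_ge0.
apply: ub_le_sup => //; exists (fnorm A) => _ [v /= v1 <-].
by apply: (le_trans (le_fnormM _ _)); rewrite -/(vnorm v) v1 mulr1.
Qed.

Lemma fnorm_mulmx_le_opnorm p q (A : 'M[R]_(p, q)) (u : 'cV[R]_q) :
  fnorm (A *m u) <= opnorm A * fnorm u.
Proof.
have [->|/unit_direction[v v1 ->]] := eqVneq u 0.
  by rewrite mulmx0 !fnorm0 mulr0.
rewrite -scalemxAr !fnormZ v1 mulr1 mulrC ler_wpM2r//.
rewrite /opnorm; apply: ub_le_sup; last by exists v.
exists (fnorm A) => _ [a /= a1 <-].
by apply: (le_trans (le_fnormM _ _)); rewrite -/(vnorm a) a1 mulr1.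
Qed.

Lemma qform_bounds m (W : 'M[R]_m) (c C : R) :
  (forall a, vnorm a = 1 -> c <= qform a W a <= C) ->
  forall u, c * fnorm u ^+ 2 <= dot u (W *m u) <= C * fnorm u ^+ 2.
Proof.
move=> cC u; have [->|/unit_direction[v v1 ->]] := eqVneq u 0.
  by rewrite fnorm0 mulmx0 dot0l expr0n/= !mulr0 lexx.
rewrite -scalemxAr dotZr dotZl fnormZ v1 mulr1 real_normK ?num_real//.
rewrite mulrA -expr2 -qformE; have /andP[? ?] := cC v v1.
by rewrite [c * _]mulrC [C * _]mulrC !ler_wpM2l ?sqr_ge0.
Qed.

Lemma coercive_unitmx m (W : 'M[R]_m) (c : R) : 0 < c ->
  (forall u : 'cV_m, c * fnorm u ^+ 2 <= dot u (W *m u)) -> W \in unitmx.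
Proof.
(* Passing to [W^T] turns the row kernel into the columns annihilated by [W]; coercivity leaves only
   zero there. *)
move=> c0 cW; rewrite -unitmx_tr -row_free_unit -kermx_eq0.
apply/rowV0P => v /sub_kermxP vW.
have Wv : W *m v^T = 0 by rewrite -[W]trmxK -trmx_mul vW trmx0.
have := cW v^T; rewrite Wv (dotC _ 0) dot0l pmulr_rle0// => v0.
apply: fnorm_eq0; rewrite -fnorm_trmx; apply/eqP.
by rewrite -sqrf_eq0 eq_le v0 sqr_ge0.
Qed.

(** For u = W^-1 v, c|u|^2 <= u.v <= |u||v|; divide by |u|. *)
Lemma coercive_inv_le m (W : 'M[R]_m) (c : R) : 0 < c ->
  (forall u : 'cV_m, c * fnorm u ^+ 2 <= dot u (W *m u)) ->
  forall v : 'cV_m, fnorm (invmx W *m v) <= c^-1 * fnorm v.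
Proof.
move=> c0 cW v; have Wu := coercive_unitmx c0 cW.
rewrite ler_pdivlMl//; have := cW (invmx W *m v); rewrite mulKVmx//.
set u := invmx W *m v => cu.
have [->|u0] := eqVneq (fnorm u) 0; first by rewrite mulr0 fnorm_ge0.
have u_gt0 : 0 < fnorm u by rewrite lt_def u0 fnorm_ge0.
rewrite -(ler_pM2l u_gt0).
have := le_trans (ler_norm _) (norm_dot_le u v); rewrite expr2 in cu; lra.
Qed.

End Operators.

(** * Second-order expansion of reciprocal-weighted means and its remainder *)

Section Expansion.
Context {R : realType} {n m d : nat}.
Implicit Types (T : 'I_n -> 'cV[R]_m) (z : 'cV[R]_m).

(** Termwise 1/(1+x) = 1 - x + x^2/(1+x). The vectors [V] are arbitrary because the identity serves
    both for T and for psi. *)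
Lemma mean_expansion T z k (V : 'I_n -> 'cV[R]_k) :
  (forall j, 0 < 1 + dot z (T j)) ->
  n%:R^-1 *: \sum_j (1 + dot z (T j))^-1 *: V j =
  n%:R^-1 *: \sum_j V j - (n%:R^-1 *: \sum_j V j *m (T j)^T) *m z +
  n%:R^-1 *: \sum_j (dot z (T j) ^+ 2 / (1 + dot z (T j))) *: V j.
Proof.
move=> zT; rewrite -scalemxAl -scalerBr -scalerDr mulmx_suml -sumrB -big_split.
congr (_ *: _); apply: eq_bigr => j _ /=.
have -> : V j *m (T j)^T *m z = dot z (T j) *: V j.
  by rewrite -mulmxA [X in _ *m X]mx11_scalar mul_mx_scalar dotC.
rewrite -{2}[V j]scale1r -scalerBl -scalerDl; congr (_ *: _).
by field; rewrite gt_eqF.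
Qed.

Lemma gram_mulmx T u v :
  gram (fun=> 1) T u v = dot u ((n%:R^-1 *: \sum_j T j *m (T j)^T) *m v).
Proof.
rewrite -scalemxAl dotZr mulmx_suml dot_sumr; congr (_ * _).
apply: eq_bigr => j _; rewrite mul1r -mulmxA [X in _ *m X]mx11_scalar.
by rewrite mul_mx_scalar dotZr -/(dot (T j) v) (dotC (T j)) mulrC.
Qed.

(** Bounding |T_j| by t and 1/(1+x) by 2 leaves the mean of (z.T_j)^2, which is the Gram form at
    z. *)
Lemma remainder_self_le T z (t b : R) : 0 <= t ->
  (forall j, 2^-1 <= 1 + dot z (T j)) -> (forall j, fnorm (T j) <= t) ->
  gram (fun=> 1) T z z <= b * fnorm z ^+ 2 ->
  fnorm (n%:R^-1 *: \sum_j (dot z (T j) ^+ 2 / (1 + dot z (T j))) *: T j) <=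
  2 * t * b * fnorm z ^+ 2.
Proof.
move=> t0 zT Tt gb; rewrite fnormZ ger0_norm ?invr_ge0//.
apply: (@le_trans _ _ (2 * t * gram (fun=> 1) T z z)); last first.
  by rewrite -[leRHS]mulrA ler_wpM2l// mulr_ge0.
rewrite /gram mulrCA ler_wpM2l ?invr_ge0//.
apply: (le_trans (le_fnorm_sum _)); rewrite mulr_sumr; apply: ler_sum => j _.
have zT0 : 0 < 1 + dot z (T j) by apply: lt_le_trans (zT j); rewrite invr_gt0.
rewrite fnormZ ger0_norm ?divr_ge0 ?sqr_ge0 ?(ltW zT0)// mul1r -expr2.
rewrite -mulrA [leRHS]mulrC ler_wpM2l ?sqr_ge0//.
apply: ler_pM => //; rewrite ?invr_ge0 ?(ltW zT0)// ?fnorm_ge0//.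
by rewrite invf_ple ?posrE.
Qed.

Lemma mean_mul_le (a b : 'I_n -> R) (A B : R) : 0 <= A -> 0 <= B ->
  n%:R^-1 * \sum_j a j ^+ 2 <= A ^+ 2 -> n%:R^-1 * \sum_j b j ^+ 2 <= B ^+ 2 ->
  n%:R^-1 * \sum_j a j * b j <= A * B.
Proof.
move=> A0 B0 aA bB; apply: (le_trans (ler_norm _)).
rewrite -(@ler_pXn2r _ 2) ?nnegrE ?mulr_ge0// real_normK ?num_real//.
rewrite [leRHS]exprMn [leLHS]exprMn.
apply: (le_trans (ler_wpM2l (sqr_ge0 _) (cauchy_schwarz a b))).
rewrite expr2 mulrACA; apply: ler_pM => //; rewrite mulr_ge0 ?invr_ge0//.
  by rewrite sumr_ge0// => j _; exact: sqr_ge0.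
by rewrite sumr_ge0// => j _; exact: sqr_ge0.
Qed.

(** Only the second moment of [V] is controlled, so the square (z.T_j)^2 is split: one factor is at
    most |z| t, the other is paired with |V_j| by Cauchy-Schwarz. *)
Lemma remainder_le T z (V : 'I_n -> 'cV[R]_d) (t p be : R) :
  0 <= t -> 0 <= p -> 0 <= be ->
  (forall j, 2^-1 <= 1 + dot z (T j)) -> (forall j, fnorm (T j) <= t) ->
  gram (fun=> 1) T z z <= be ^+ 2 * fnorm z ^+ 2 ->
  n%:R^-1 * \sum_j fnorm (V j) ^+ 2 <= p ^+ 2 ->
  fnorm (n%:R^-1 *: \sum_j (dot z (T j) ^+ 2 / (1 + dot z (T j))) *: V j) <=
  2 * t * p * be * fnorm z ^+ 2.
Proof.
move=> t0 p0 be0 zT Tt gb pV; rewrite fnormZ ger0_norm ?invr_ge0//.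
have H : n%:R^-1 * \sum_j fnorm (V j) * `|dot z (T j)| <= p * (be * fnorm z).
  apply: mean_mul_le => //; first by rewrite mulr_ge0 ?fnorm_ge0.
  rewrite exprMn (le_trans _ gb)// /gram.
  under eq_bigr do rewrite real_normK ?num_real// expr2 -[_ * _]mul1r.
  by [].
apply: (@le_trans _ _ (2 * t * fnorm z *
    (n%:R^-1 * \sum_j fnorm (V j) * `|dot z (T j)|))); last first.
  have -> : 2 * t * p * be * fnorm z ^+ 2 = 2 * t * fnorm z * (p * (be * fnorm z)).
    by ring.
  by rewrite ler_wpM2l// !mulr_ge0 ?fnorm_ge0.
rewrite mulrCA ler_wpM2l ?invr_ge0//.
apply: (le_trans (le_fnorm_sum _)); rewrite mulr_sumr; apply: ler_sum => j _.
have zT0 : 0 < 1 + dot z (T j) by apply: lt_le_trans (zT j); rewrite invr_gt0.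
rewrite fnormZ ger0_norm ?divr_ge0 ?sqr_ge0 ?(ltW zT0)//.
rewrite -[dot z (T j) ^+ 2]real_normK ?num_real//.
have x0 := normr_ge0 (dot z (T j)).
have xzt : `|dot z (T j)| <= fnorm z * t.
  by apply: (le_trans (norm_dot_le _ _)); rewrite ler_wpM2l ?fnorm_ge0.
have i2 : (1 + dot z (T j))^-1 <= 2 by rewrite invf_ple ?posrE.
have -> : 2 * t * fnorm z * (fnorm (V j) * `|dot z (T j)|) =
   (fnorm z * t * `|dot z (T j)|) * 2 * fnorm (V j) by ring.
rewrite ler_wpM2r ?fnorm_ge0//; apply: ler_pM => //.
- by rewrite invr_ge0 ltW.
- by rewrite expr2 ler_wpM2r.
Qed.

(** Cauchy-Schwarz reduces this to the mean of |T_j|^2, which is the trace of the Gram form, a sum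
    over the standard basis. *)
Lemma mean_outer_le T (V : 'I_n -> 'cV[R]_d) (p be : R) :
  0 <= p -> 0 <= be ->
  (forall u, gram (fun=> 1) T u u <= be ^+ 2 * fnorm u ^+ 2) ->
  n%:R^-1 * \sum_j fnorm (V j) ^+ 2 <= p ^+ 2 ->
  fnorm (n%:R^-1 *: \sum_j V j *m (T j)^T) <= p * (be * m%:R).
Proof.
move=> p0 be0 gb pV; rewrite fnormZ ger0_norm ?invr_ge0//.
apply: (@le_trans _ _ (n%:R^-1 * \sum_j fnorm (V j) * fnorm (T j))).
  rewrite ler_wpM2l ?invr_ge0//; apply: (le_trans (le_fnorm_sum _)).
  by apply: ler_sum => j _; rewrite -(fnorm_trmx (T j)); exact: le_fnormM.
apply: mean_mul_le => //; first by rewrite mulr_ge0.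
have -> : n%:R^-1 * \sum_j fnorm (T j) ^+ 2 =
    \sum_i gram (fun=> 1) T (delta_mx i 0) (delta_mx i 0).
  rewrite -mulr_sumr exchange_big; congr (_ * _); apply: eq_bigr => j _.
  rewrite -dotvv dotE; apply: eq_bigr => i _.
  by rewrite mul1r /dot trmx_delta -rowE mxE.
apply: (@le_trans _ _ (\sum_(i < m) be ^+ 2)).
  apply: ler_sum => i _; apply: (le_trans (gb _)).
  suff -> : fnorm (delta_mx i 0 : 'cV[R]_m) ^+ 2 = 1 by rewrite mulr1.
  by rewrite -dotvv /dot trmx_delta mul_delta_mx mxE !eqxx.
(* The trace bound m be^2 is relaxed to (m be)^2, which avoids a square root of m. *)
rewrite sumr_const card_ord exprMn -[leLHS]mulr_natr.
apply: ler_wpM2l; first exact: sqr_ge0.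
by rewrite -natrX ler_nat; case: (m) => // k; rewrite expnS leq_pmulr// expn_gt0.
Qed.

End Expansion.

(** * Existence and expansion for a fixed outcome *)

Section Deterministic.
Context {R : realType} {n m d : nat}.
Variables (T : 'I_n -> 'cV[R]_m) (W : 'M[R]_m) (c C : R).
Hypothesis c_gt0 : 0 < c.
Hypothesis W_bounds :
  forall u : 'cV_m, c * fnorm u ^+ 2 <= dot u (W *m u) <= C * fnorm u ^+ 2.

Let S := n%:R^-1 *: \sum_j T j *m (T j)^T.
Let Tbar := n%:R^-1 *: \sum_j T j.

(** Perturbation of W by S - W, which changes the form by at most c/2 |u|^2. Taking [|C|] keeps the
    upper constant above c/2 whatever the sign of [C]. *)
Lemma gram_bounds : opnorm (S - W) <= c / 2 ->
  forall u, c / 2 * fnorm u ^+ 2 <= gram (fun=> 1) T u u <=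
            (`|C| + c) * fnorm u ^+ 2.
Proof.
move=> sc u; rewrite gram_mulmx -/S -[S in S *m u](subrK W) mulmxDl dotDr.
have /andP[w1 w2] := W_bounds u.
have u2 : 0 <= fnorm u ^+ 2 by rewrite sqr_ge0.
have C1 : C * fnorm u ^+ 2 <= `|C| * fnorm u ^+ 2 by rewrite ler_wpM2r// ler_norm.
have : `|dot u ((S - W) *m u)| <= c / 2 * fnorm u ^+ 2.
  apply: (le_trans (norm_dot_le _ _)).
  rewrite expr2 mulrCA ler_wpM2l ?fnorm_ge0//.
  apply: (le_trans (fnorm_mulmx_le_opnorm _ _)).
  by rewrite ler_wpM2r ?fnorm_ge0.
rewrite ler_norml => /andP[h1 h2].
have : 0 <= c * fnorm u ^+ 2 by rewrite mulr_ge0// ltW.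
by move=> ?; apply/andP; split; lra.
Qed.

Lemma el_exists (t : R) : opnorm (S - W) <= c / 2 ->
  (forall j, fnorm (T j) <= t) -> 16 / c * fnorm Tbar * t <= 2^-1 ->
  exists z, [/\ eladm T z, fnorm z <= 16 / c * fnorm Tbar,
    forall j, 2^-1 <= 1 + dot z (T j) & forall z', eladm T z' -> z' = z].
Proof.
move=> sc Tt rt; have gb := gram_bounds sc.
have a0 : 0 < c / 2 by rewrite divr_gt0.
have ab : c / 2 <= `|C| + c by have := normr_ge0 C; lra.
have E : 8 / (c / 2) = 16 / c by field; rewrite gt_eqF.
have [|z [zadm zr zh]] := eladm_exists a0 ab gb.
  move=> j; rewrite E; apply: (le_trans _ rt); rewrite ler_wpM2l//.
  by rewrite mulr_ge0 ?fnorm_ge0// divr_ge0// ltW.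
exists z; split=> //; first by rewrite -E.
move=> z' z'adm; apply: (eladm_unique a0 _ z'adm zadm) => u.
by case/andP: (gb u).
Qed.

Variables (Psi Chi : 'I_n -> 'cV[R]_d) (A : 'M[R]_(d, m)).
Let M := n%:R^-1 *: \sum_j Psi j *m (T j)^T.

(** The four summands bound, in order, the chi-remainder [e1], the effect [e2] of replacing z by
    W^-1 mean T, the effect [e3] of replacing M by A, and the quadratic remainder [rPsi]. *)
Lemma el_expansion (z : 'cV[R]_m) (t p be : R) :
  opnorm (S - W) <= c / 2 -> `|C| + c <= be ^+ 2 ->
  0 <= t -> 0 <= p -> 0 <= be -> (forall j, fnorm (T j) <= t) ->
  n%:R^-1 * \sum_j fnorm (Psi j) ^+ 2 <= p ^+ 2 ->
  eladm T z -> (forall j, 2^-1 <= 1 + dot z (T j)) ->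
  fnorm (n%:R^-1 *: \sum_j (1 + dot z (T j))^-1 *: Psi j -
         (n%:R^-1 *: \sum_j Psi j - n%:R^-1 *: \sum_j Chi j)) <=
  fnorm (A *m invmx W *m Tbar - n%:R^-1 *: \sum_j Chi j) +
  (fnorm (M - A) + p * (be * m%:R)) * (c^-1 *
     (2 * be ^+ 2 * (t * fnorm z ^+ 2) + opnorm (S - W) * fnorm z)) +
  fnorm (M - A) * fnorm z + 2 * p * be * (t * fnorm z ^+ 2).
Proof.
move=> sc Cbe t0 p0 be0 Tt pPsi [zT sz] zh.
have gbe u : gram (fun=> 1) T u u <= be ^+ 2 * fnorm u ^+ 2.
  have /andP[_] := gram_bounds sc u; move=> /le_trans; apply.
  by rewrite ler_wpM2r ?sqr_ge0.
have cW u : c * fnorm u ^+ 2 <= dot u (W *m u) by case/andP: (W_bounds u).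
set chib := n%:R^-1 *: \sum_j Chi j.
rewrite mean_expansion// -/M.
set rPsi := n%:R^-1 *: \sum_j (dot z (T j) ^+ 2 / (1 + dot z (T j))) *: Psi j.
have := mean_expansion T zT; rewrite -/(elscore T z) sz -/S -/Tbar.
set rT := n%:R^-1 *: \sum_j (dot z (T j) ^+ 2 / (1 + dot z (T j))) *: T j.
move=> zE.
(* The score equation reads 0 = Tbar - S z + rT; writing S = W + (S - W) and inverting W isolates
   z. *)
have Wz : z = invmx W *m (Tbar + (rT - (S - W) *m z)).
  apply: (canRL (mulKmx (coercive_unitmx c_gt0 cW))).
  have -> : rT = S *m z - Tbar.
    by rewrite -[S *m z]addr0 {1}zE; apply/matrixP => i j; rewrite !mxE; ring.
  by rewrite mulmxBl; apply/matrixP => i j; rewrite !mxE; ring.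
pose e1 := A *m invmx W *m Tbar - chib.
pose e2 := A *m (invmx W *m (rT - (S - W) *m z)).
pose e3 := (M - A) *m z.
rewrite [X in fnorm X](_ : _ = rPsi - e1 - e2 - e3); last first.
  have Az : A *m z = A *m invmx W *m Tbar + e2.
    by rewrite {1}Wz /e2 mulmxDr mulmxDr mulmxA.
  rewrite /e3 mulmxBl Az /e1; apply/matrixP => i j; rewrite !mxE; ring.
have He2 : fnorm e2 <= (fnorm (M - A) + p * (be * m%:R)) * (c^-1 *
     (2 * be ^+ 2 * (t * fnorm z ^+ 2) + opnorm (S - W) * fnorm z)).
  apply: (le_trans (le_fnormM _ _)); apply: ler_pM; rewrite ?fnorm_ge0//.
    (* The size of A is controlled through M, whose norm is bounded by second moments. *)
    have -> : A = M - (M - A) by rewrite subKr.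
    apply: (le_trans (le_fnormB _ _)); rewrite subKr addrC lerD2l.
    exact: mean_outer_le.
  apply: (le_trans (coercive_inv_le c_gt0 cW _)).
  rewrite ler_wpM2l ?invr_ge0 ?(ltW c_gt0)//.
  apply: (le_trans (le_fnormB _ _)); apply: lerD; last exact: fnorm_mulmx_le_opnorm.
  apply: (le_trans (remainder_self_le t0 zh Tt (gbe z))).
  by rewrite le_eqVlt; apply/orP; left; apply/eqP; ring.
have He3 : fnorm e3 <= fnorm (M - A) * fnorm z by exact: le_fnormM.
have Hr : fnorm rPsi <= 2 * p * be * (t * fnorm z ^+ 2).
  apply: (le_trans (remainder_le t0 p0 be0 zh Tt (gbe z) pPsi)).
  by rewrite le_eqVlt; apply/orP; left; apply/eqP; ring.
have := le_fnormB (rPsi - e1 - e2) e3; have := le_fnormB (rPsi - e1) e2.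
have := le_fnormB rPsi e1; rewrite -/e1; lra.
Qed.

End Deterministic.

(* [rho] bounds sqrt(n) |zeta_n| when sqrt(n) |mean T| <= M. *)
Definition el_rate {R : realType} (m : nat) (c be M : R) : R :=
  let rho := 16 / c * M in
  1 + (1 + M * (be * m%:R)) * (c^-1 * (2 * be ^+ 2 * rho ^+ 2 + rho)) +
  rho + 2 * M * be * rho ^+ 2.

(** Here [N] stands for sqrt(n). Every term carries one small factor [del] and one factor 1/N; for
    instance t z^2 <= (del N)(rho/N)^2 = (del/N) rho^2. The bound del <= 1 replaces f by 1 in the
    factor f + M be m. *)
Lemma el_rate_bound {R : realType} (m : nat) (c be M N del t s f x tau z : R) :
  0 < c -> 0 <= be -> 0 <= M -> 0 < N -> 0 <= del <= 1 ->
  0 <= t <= del * N -> 0 <= s <= del -> 0 <= f <= del -> x <= del / N ->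
  0 <= z <= 16 / c * tau -> tau <= M / N ->
  x + (f + M * (be * m%:R)) * (c^-1 * (2 * be ^+ 2 * (t * z ^+ 2) + s * z)) +
    f * z + 2 * M * be * (t * z ^+ 2) <= del / N * el_rate m c be M.
Proof.
move=> c0 be0 M0 N0 /andP[d0 d1] /andP[t0 td] /andP[s0 sd] /andP[f0 fd] xd.
move=> /andP[z0 zt] tauM; rewrite /el_rate; set rho := 16 / c * M.
have rho0 : 0 <= rho by rewrite mulr_ge0// divr_ge0// ltW.
have y0 : 0 <= del / N by rewrite divr_ge0// ltW.
have zrho : z <= rho / N.
  apply: (le_trans zt); rewrite /rho -[leRHS]mulrA ler_wpM2l// divr_ge0// ltW//.
have tz : t * z ^+ 2 <= del / N * rho ^+ 2.
  have -> : del / N * rho ^+ 2 = (del * N) * (rho / N) ^+ 2.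
    by field; rewrite gt_eqF.
  apply: ler_pM => //; first exact: sqr_ge0.
  by rewrite ler_pXn2r ?nnegrE// divr_ge0// ltW.
have dz g : 0 <= g <= del -> g * z <= del / N * rho.
  move=> /andP[g0 gd]; rewrite mulrAC -mulrA; exact: ler_pM.
have sz := dz s; have fz := dz f; rewrite s0 sd f0 fd in sz fz.
have {}sz := sz isT; have {}fz := fz isT.
set k1 := M * (be * m%:R); have k10 : 0 <= k1 by rewrite !mulr_ge0.
have be2 : 0 <= 2 * be ^+ 2 by rewrite mulr_ge0// sqr_ge0.
have h1 : (f + k1) * (c^-1 * (2 * be ^+ 2 * (t * z ^+ 2) + s * z)) <=
   del / N * ((1 + k1) * (c^-1 * (2 * be ^+ 2 * rho ^+ 2 + rho))).
  rewrite [leRHS]mulrCA; apply: ler_pM.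
  - by rewrite addr_ge0.
  - by rewrite mulr_ge0 ?invr_ge0 ?(ltW c0)// addr_ge0 ?mulr_ge0 ?sqr_ge0.
  - by rewrite lerD2r (le_trans fd).
  rewrite [leRHS]mulrCA ler_wpM2l ?invr_ge0 ?(ltW c0)// mulrDr lerD//.
  by rewrite [leRHS]mulrCA ler_wpM2l.
have h2 : 2 * M * be * (t * z ^+ 2) <= del / N * (2 * M * be * rho ^+ 2).
  by rewrite [leRHS]mulrCA ler_wpM2l// !mulr_ge0.
by lra.
Qed.

(** * Outer probability bounds, measurable covers, and Markov's inequality *)

Section OuterProbability.
Context {R : realType} {dO : measure_display} {Omega : measurableType dO}.
Variable P : probability Omega R.

(** The cover condition inside [outer_prob_to0] and [big_Op]. Covers are used because the events
    involve operator norms and chosen multipliers, whose measurability is not established. *)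
Definition outer_le (e : R) (A : set Omega) : Prop :=
  exists B : set Omega, [/\ measurable B, A `<=` B & P B <= e%:E]%E.

Lemma outer_leS e (A B : set Omega) : A `<=` B -> outer_le e B -> outer_le e A.
Proof. by move=> AB [C [mC BC PC]]; exists C; split=> //; apply: subset_trans BC. Qed.

Lemma outer_leU e1 e2 (A B : set Omega) :
  outer_le e1 A -> outer_le e2 B -> outer_le (e1 + e2) (A `|` B).
Proof.
move=> [C [mC AC PC]] [D [mD BD PD]]; exists (C `|` D); split.
- exact: measurableU.
- exact: setUSS.
- have := @measureU2 _ _ _ P _ _ mC mD; move/le_trans; apply.
  by rewrite EFinD leeD.
Qed.

(* Uniformly in the target bound, a cover can be chosen within 1/(n+1) of the
   infimum of all admissible bounds. *)
Lemma outer_prob_to0_cover (A : nat -> set Omega) : outer_prob_to0 P A ->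
  exists B : nat -> set Omega, [/\ forall n, measurable (B n),
    forall n, A n `<=` B n & P (B n) @[n --> \oo] --> 0%E].
Proof.
move=> A0.
have step n : exists B : set Omega, [/\ measurable B, A n `<=` B &
    forall e, outer_le e (A n) -> (P B <= (e + n.+1%:R^-1)%:E)%E].
  pose E := [set e | outer_le e (A n)].
  have E_inf : has_inf E.
    split; first by exists 1, setT; split=> //; rewrite probability_setT.
    exists 0 => e [B [_ _ PB]].
    by rewrite -lee_fin (le_trans _ PB)// measure_ge0.
  have [|e [B [mB AB PB]] eE] := @inf_adherent R E n.+1%:R^-1 _ E_inf.
    by rewrite invr_gt0.
  exists B; split=> // e' Ee'; apply: (le_trans PB).
  rewrite lee_fin (le_trans (ltW eE))// lerD2r.
  exact: (inf_lbound (proj2 E_inf)).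
have [B BP] := choice step; exists B.
split; [by move=> n; have [] := BP n | by move=> n; have [] := BP n | ].
apply/fine_cvgP; split; first by near=> n; apply: fin_num_measure; have [] := BP n.
apply/cvgr0Pnorm_le => e e0.
have e2 : 0 < e / 2 by rewrite divr_gt0.
have n1 := near_infty_natSinv_lt (PosNum e2).
near=> n; rewrite /= ger0_norm ?fine_ge0 ?measure_ge0//.
have [mB _ BE] := BP n.
rewrite -lee_fin fineK ?fin_num_measure//.
have : (P (B n) <= (e / 2 + n.+1%:R^-1)%:E)%E.
  by apply: BE; near: n; exact: A0.
move/le_trans; apply; rewrite lee_fin.
have : n.+1%:R^-1 < e / 2 :> R by near: n.
by move=> h; rewrite [leRHS](splitr e) lerD2l ltW.
Unshelve. all: by end_near. Qed.

Lemma cvg_probability_setC (B : nat -> set Omega) : (forall n, measurable (B n)) ->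
  P (B n) @[n --> \oo] --> 0%E -> P (~` B n) @[n --> \oo] --> 1%E.
Proof.
move=> mB B0; under eq_fun do rewrite probability_setC//.
have c1 : (1 : \bar R)%E @[n --> \oo] --> (1 : \bar R)%E by exact: cvg_cst.
have d1 : ((1 : \bar R) +? - 0)%E by [].
by have := cvgeB d1 c1 B0; rewrite sube0; apply.
Qed.

(** Markov's inequality, the expectation of the mean being at most [V] by linearity. *)
Lemma mean_tail_le (X : nat -> Omega -> R) (V M : R) n : 0 < M ->
  (forall j, measurable_fun setT (X j)) -> (forall j w, 0 <= X j w) ->
  (forall j, \int[P]_w (X j w)%:E = V%:E)%E ->
  outer_le (V / M) [set w | M < n%:R^-1 * \sum_(j < n) X j w].
Proof.
move=> M0 mX X0 XV; pose mean w := n%:R^-1 * \sum_(j < n) X j w.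
have V0 : 0 <= V by rewrite -lee_fin -(XV 0%N) integral_ge0// => w _; rewrite lee_fin.
have mmean : measurable_fun setT mean.
  by apply: measurable_funM => //; exact: measurable_sum.
have mean0 w : 0 <= mean w by rewrite mulr_ge0 ?invr_ge0 ?sumr_ge0.
exists [set w | (M%:E <= `|(mean w)%:E|)%E]; split.
- rewrite (_ : [set _ | _] = mean @^-1` `[M, +oo[); last first.
    apply/seteqP; split => w /=; rewrite lee_fin ger0_norm// in_itv/= andbT//.
  by rewrite -[X in measurable X]setTI; exact: mmean.
- by move=> w /= Mw; rewrite lee_fin ger0_norm// ltW.
have /measurable_EFinP mE := mmean.
have := le_integral_abse P measurableT mE M0; rewrite setTI.
have -> : (\int[P]_x `|(EFin \o mean) x|)%E =
    (\int[P]_w ((n%:R^-1)%:E * \sum_(j < n) (X j w)%:E))%E.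
  apply: eq_integral => w _ /=.
  by rewrite ger0_norm// /mean EFinM sumEFin.
rewrite ge0_integralZl_EFin ?invr_ge0//; last 2 first.
- by move=> w _; rewrite sume_ge0// => j _; rewrite lee_fin.
- by apply: emeasurable_sum => j; exact/measurable_EFinP.
rewrite ge0_integral_sum//; last 2 first.
- by move=> j; exact/measurable_EFinP.
- by move=> j w _; rewrite lee_fin.
under eq_bigr do rewrite XV.
rewrite sumEFin sumr_const card_ord -EFinM => H.
have : (M%:E * P [set w | (M%:E <= `|(mean w)%:E|)%E] <= V%:E)%E.
  apply: (le_trans H); rewrite lee_fin -[V *+ n]mulr_natl mulrA.
  (* For n = 0 the inverse is 0 by convention and the bound reduces to 0 <= V. *)
  have [->|n0] := eqVneq (n%:R : R) 0; first by rewrite mulr0 mul0r.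
  by rewrite mulVf// mul1r.
by rewrite muleC -lee_pdivlMr// EFinM muleC.
Qed.

End OuterProbability.

(** Change of variables: the pushforward of P by [X j] agrees with Q on measurable sets. *)
Lemma iid_integral (R : realType) (dO : measure_display) (Omega : measurableType dO)
    (P : probability Omega R) (dz : measure_display) (Z : measurableType dz)
    (Q : probability Z R) (X : nat -> Omega -> Z) (f : Z -> \bar R) j :
  iid P Q X -> measurable_fun setT f -> (forall z, 0 <= f z)%E ->
  (\int[P]_w f (X j w) = \int[Q]_z f z)%E.
Proof.
move=> [mX XQ _] mf f0.
have := ge0_integral_pushforward (mX j) P measurableT mf (fun z _ => f0 z).
rewrite preimage_setT => <-.
by apply: eq_measure_integral => A mA _; exact: XQ.
Qed.

Lemma little_op_near (R : realType) (dO : measure_display) (Omega : measurableType dO)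
    (P : probability Omega R) (X : nat -> Omega -> R) (r : nat -> R) (eps e : R) :
  little_op P X r -> 0 < eps -> 0 < e ->
  \forall n \near \oo, outer_le P e [set w | eps * r n < `|X n w|].
Proof. by move=> Xr eps0 e0; exact: Xr. Qed.

Lemma sqrtn_gt0 (R : realType) : \forall n \near \oo, 0 < Num.sqrt (n%:R : R).
Proof. by exists 1%N => // n /= n0; rewrite sqrtr_gt0 ltr0n. Qed.

(** * Combination of the fixed-outcome estimates with the stochastic orders *)

Theorem theorem6 (R : realType)
  (dO : measure_display) (Omega : measurableType dO) (P : probability Omega R)
  (dz : measure_display) (Zsp : measurableType dz) (Q : probability Zsp R)
  (d m : nat) (hm : (0 < m)%N)
  (Z : nat -> Omega -> Zsp)
  (psi : Zsp -> 'cV[R]_d) (chi : Zsp -> 'cV[R]_d)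
  (T : nat -> nat -> Omega -> 'cV[R]_m)
  (W : nat -> 'M[R]_m) :
  iid P Q Z ->
  (forall i, measurable_fun setT (fun z => psi z i 0)) ->
  (\int[Q]_z ((vnorm (psi z)) ^+ 2)%:E < +oo)%E ->
  (forall n j i, measurable_fun setT (fun w => T n j w i 0)) ->
  (* the expectations E(psi(Z_j) T_nj^T) exist *)
  (forall n j i k, (j < n)%N ->
     P.-integrable setT (fun w => ((psi (Z j w) *m (T n j w)^T) i k)%:E)) ->
  let Tstar n w := \big[Num.max/0]_(j < n) vnorm (T n j w) in
  let Tbar n w := n%:R^-1 *: \sum_(j < n) T n j w in
  let S n w := n%:R^-1 *: \sum_(j < n) (T n j w *m (T n j w)^T) in
  let A n := n%:R^-1 *: \sum_(j < n) Emx P (fun w => psi (Z j w) *m (T n j w)^T) in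
  little_op P Tstar (fun n => Num.sqrt n%:R) ->
  big_Op P (fun n w => vnorm (Tbar n w)) (fun n => (Num.sqrt n%:R)^-1) ->
  regular_dispersion W ->
  little_op P (fun n w => opnorm (S n w - W n)) (fun=> 1) ->
  little_op P (fun n w => fnorm (n%:R^-1 *: \sum_(j < n)
       (psi (Z j w) *m (T n j w)^T - Emx P (fun w' => psi (Z j w') *m (T n j w')^T))))
     (fun=> 1) ->
  (forall i, measurable_fun setT (fun z => chi z i 0)) ->
  (forall i, (\int[Q]_z (chi z i 0)%:E = 0)%E) ->
  (\int[Q]_z ((vnorm (chi z)) ^+ 2)%:E < +oo)%E ->
  little_op P (fun n w => vnorm (n%:R^-1 *: \sum_(i < n)
       (A n *m invmx (W n) *m T n i w - chi (Z i w))))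
     (fun n => (Num.sqrt n%:R)^-1) ->
  exists (E : nat -> set Omega) (zeta : nat -> Omega -> 'cV[R]_m),
    [/\ forall n, measurable (E n),
        (fun n => P (E n)) @ \oo --> 1%E,
        forall n w, E n w ->
          let adm (z : 'cV[R]_m) :=
            (forall j, (j < n)%N -> 0 < 1 + ((z^T *m T n j w) 0 0)) /\
            n%:R^-1 *: \sum_(j < n) ((1 + ((z^T *m T n j w) 0 0))^-1 *: T n j w) = 0
          in adm (zeta n w) /\ (forall z, adm z -> z = zeta n w)
      & forall eps : R, 0 < eps -> outer_prob_to0 P (fun n =>
          E n `&` [set w | eps * (Num.sqrt n%:R)^-1 <
            vnorm (n%:R^-1 *: \sum_(j < n)
                     ((1 + ((zeta n w)^T *m T n j w) 0 0)^-1 *: psi (Z j w))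
                   - (n%:R^-1 *: \sum_(j < n) psi (Z j w)
                      - n%:R^-1 *: \sum_(j < n) chi (Z j w)))])].
Proof.
move=> iidZ mpsi psi2 _ _ Tstar Tbar S A oT OTbar [_ [c [C [c0 WcC]]]] oS oM _ _ _ oX.
pose Tn n w (j : 'I_n) := T n j w.
have Wb n := qform_bounds (WcC n).
have Tt n w (j : 'I_n) : fnorm (Tn n w j) <= Tstar n w.
  exact: (le_bigmax _ (fun j : 'I_n => vnorm (T n j w)) j).
have Tstar0 n w : 0 <= Tstar n w by rewrite /Tstar bigmax_idl le_max lexx.
(* Exactly the conditions of [el_exists], with [Tstar] as the bound on the |T_j|. *)
pose good n w := opnorm (S n w - W n) <= c / 2 /\
                 16 / c * fnorm (Tbar n w) * Tstar n w <= 2^-1.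
have goodP n w : exists z, good n w -> [/\ eladm (Tn n w) z,
    fnorm z <= 16 / c * fnorm (Tbar n w),
    forall j, 2^-1 <= 1 + dot z (Tn n w j)
  & forall z', eladm (Tn n w) z' -> z' = z].
  have [[g1 g2]|ng] := pselect (good n w); last by exists 0.
  have [z zP] := el_exists c0 (Wb n) g1 (Tt n w) g2.
  by exists z.
pose zeta n w := sval (cid (goodP n w)).
have zetaP n w : good n w -> [/\ eladm (Tn n w) (zeta n w),
    fnorm (zeta n w) <= 16 / c * fnorm (Tbar n w),
    forall j, 2^-1 <= 1 + dot (zeta n w) (Tn n w j)
  & forall z', eladm (Tn n w) z' -> z' = zeta n w].
  by move=> gnw; exact: (svalP (cid (goodP n w))).
have bad0 : outer_prob_to0 P (fun n => [set w | ~ good n w]).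
  move=> e e0; have e3 : 0 < e / 3 by rewrite divr_gt0.
  have [M [M0 OM]] := OTbar _ e3.
  have c2 : 0 < c / 2 by rewrite divr_gt0.
  (* With |Tbar| <= M/sqrt(n) and Tstar <= c/(32M) sqrt(n) the product is at most c/32, and 16/c
     times this is 1/2. *)
  have del0 : 0 < c / (32 * M) by rewrite divr_gt0 ?mulr_gt0.
  have near0 := @sqrtn_gt0 R.
  have nearS := little_op_near oS c2 e3.
  have nearT := little_op_near oT del0 e3.
  near=> n.
  have N0 : 0 < Num.sqrt (n%:R : R) by near: n.
  have HM := near OM n _; have HS := near nearS n _; have HT := near nearT n _.
  rewrite -/(outer_le P e _).
  rewrite (_ : e = e / 3 + e / 3 + e / 3); last by field.
  apply: outer_leS (outer_leU (outer_leU (HM _) (HS _)) (HT _)) => // w /= ng.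
  apply: contrapT => /not_orP[/not_orP[/negP + /negP +] /negP +].
  rewrite -!leNgt mulr1 => h1 h2 h3; apply: ng; split.
    by apply: (le_trans (ler_norm _)).
  have k1 := le_trans (ler_norm _) h1; have k3 := le_trans (ler_norm _) h3.
  have : fnorm (Tbar n w) * Tstar n w <=
      M * (Num.sqrt n%:R)^-1 * (c / (32 * M) * Num.sqrt n%:R).
    by apply: ler_pM => //; exact: fnorm_ge0.
  have -> : M * (Num.sqrt n%:R)^-1 * (c / (32 * M) * Num.sqrt n%:R) = c / 32.
    by field; rewrite !gt_eqF.
  move=> H; rewrite -mulrA.
  have -> : 2^-1 = 16 / c * (c / 32) by field; rewrite gt_eqF.
  by rewrite ler_wpM2l// divr_ge0// ltW.
(* The event E_n is the complement of a measurable cover of the bad set. *)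
have [B [mB badB B0]] := outer_prob_to0_cover bad0.
have Egood n w : (~` B n) w -> good n w.
  by move=> nB; apply: contrapT => /(badB n w).
exists (fun n => ~` B n), zeta; split.
- by move=> n; exact: measurableC.
- exact: cvg_probability_setC.
- move=> n w /Egood/zetaP[[zT sz] _ _ uz] adm; split.
    split; last exact: sz.
    by move=> j jn; exact: (zT (Ordinal jn)).
  move=> z [zT' sz']; apply: uz; split; last exact: sz'.
  by move=> j; exact: zT'.
(* One sixth of [e] for each exceptional set: those of Tbar, S - W, Tstar, M - A, the chi-remainder
   and the mean of |psi|^2. *)
move=> eps eps0 e e0; have e6 : 0 < e / 6 by rewrite divr_gt0.
have [M1 [M1_gt0 OM]] := OTbar _ e6.
pose V := fine (\int[Q]_z ((vnorm (psi z)) ^+ 2)%:E)%E.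
have mpsi2 : measurable_fun setT (fun z => vnorm (psi z) ^+ 2).
  apply: (eq_measurable_fun (fun z => \sum_(i < d) \sum_(j < 1) psi z i j ^+ 2)).
    by move=> z _; rewrite /vnorm sqr_fnorm.
  apply: measurable_sum => i; apply: measurable_sum => j.
  by rewrite (ord1 j); exact: measurable_funX.
have psiV j : (\int[P]_w (vnorm (psi (Z j w)) ^+ 2)%:E = V%:E)%E.
  rewrite (iid_integral (f := fun z => (vnorm (psi z) ^+ 2)%:E) j iidZ) /V.
  - rewrite fineK// ge0_fin_numE// integral_ge0// => z _.
    by rewrite lee_fin sqr_ge0.
  - exact/measurable_EFinP.
  - by move=> z; rewrite lee_fin sqr_ge0.
have V0 : 0 <= V by rewrite fine_ge0// integral_ge0// => z _; rewrite lee_fin sqr_ge0.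
(* Chosen so that V = (e/6)(M2 - 1) <= (e/6) M2^2, which is what Markov's inequality requires. *)
pose M2 := 1 + 6 * V / e.
have M2_ge1 : 1 <= M2 by rewrite lerDl divr_ge0 ?mulr_ge0// ltW.
have Htail n : outer_le P (e / 6)
    [set w | M2 ^+ 2 < n%:R^-1 * \sum_(j < n) vnorm (psi (Z j w)) ^+ 2].
  have M2_2 : 0 < M2 ^+ 2 by rewrite exprn_gt0//; lra.
  have := @mean_tail_le R dO Omega P (fun j w => vnorm (psi (Z j w)) ^+ 2) V
    (M2 ^+ 2) n M2_2 _ _ psiV.
  have mZ j : measurable_fun setT (Z j) by case: iidZ.
  have H1 j : measurable_fun setT (fun w => vnorm (psi (Z j w)) ^+ 2).
    exact: (measurableT_comp mpsi2 (mZ j)).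
  have H2 j w : 0 <= vnorm (psi (Z j w)) ^+ 2 by exact: sqr_ge0.
  move=> /(_ H1 H2)[D [mD AD PD]]; exists D; split=> //; apply: (le_trans PD).
  rewrite lee_fin ler_pdivrMr//.
  have -> : V = e / 6 * (M2 - 1) by rewrite /M2; field; rewrite gt_eqF.
  by rewrite ler_wpM2l ?(ltW e6)//; nra.
(* A single constant [M0] dominates both bounds, as [el_rate] expects; [be] is at least 1 so that
   its square dominates |C| + c. *)
pose M0 := M1 + M2; pose be := 1 + `|C| + c.
have M0_ge0 : 0 <= M0 by rewrite /M0; lra.
have be_ge1 : 1 <= be by rewrite /be; have := normr_ge0 C; lra.
have be_ge0 : 0 <= be by lra.
have Cbe : `|C| + c <= be ^+ 2 by rewrite /be; have := normr_ge0 C; nra.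
pose K := el_rate m c be M0.
have K0 : 0 <= K.
  rewrite /K /el_rate; set rho := 16 / c * M0.
  have rho0 : 0 <= rho by rewrite mulr_ge0// divr_ge0// ltW.
  by rewrite !(addr_ge0, mulr_ge0, invr_ge0, sqr_ge0)// ltW.
(* The minimum with 1 meets the condition of [el_rate_bound]; the other term gives del K <= eps, and
   K + 1 keeps the denominator positive. *)
pose del := Num.min 1 (eps / (K + 1)).
have del0 : 0 < del by rewrite lt_min ltr01 divr_gt0//; lra.
have del1 : del <= 1 by rewrite ge_min lexx.
have delK : del * K <= eps.
  apply: (@le_trans _ _ (eps / (K + 1) * (K + 1))); last by rewrite divfK ?gt_eqF//; lra.
  by apply: ler_pM; rewrite ?(ltW del0)//; [rewrite ge_min lexx orbT|lra].
have near0 := @sqrtn_gt0 R.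
have nearS := little_op_near oS del0 e6.
have nearT := little_op_near oT del0 e6.
have nearM := little_op_near oM del0 e6.
have nearX := little_op_near oX del0 e6.
near=> n.
have N0 : 0 < Num.sqrt (n%:R : R) by near: n.
have HM := near OM n _; have HS := near nearS n _; have HT := near nearT n _.
have HF := near nearM n _; have HX := near nearX n _.
rewrite -/(outer_le P e _).
rewrite (_ : e = e / 6 + e / 6 + e / 6 + e / 6 + e / 6 + e / 6); last by field.
apply: outer_leS (outer_leU (outer_leU (outer_leU (outer_leU (outer_leU
  (HM _) (HS _)) (HT _)) (HF _)) (HX _)) (Htail n)) => // w [/Egood gw /= err].
(* Outside all six sets the expansion error is at most (del/sqrt(n)) K <= eps/sqrt(n), contradicting
   [err]. *)
apply: contrapT.
move=> /not_orP[/not_orP[/not_orP[/not_orP[/not_orP[/negP + /negP +] /negP +]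
  /negP +] /negP +] /negP +].
rewrite -!leNgt !mulr1 => hTbar hS hT hF hX hpsi.
have {}hTbar := le_trans (ler_norm _) hTbar.
have {}hS := le_trans (ler_norm _) hS.
have {}hT := le_trans (ler_norm _) hT.
have {}hF := le_trans (ler_norm _) hF.
have {}hX := le_trans (ler_norm _) hX.
have [g1 g2] := gw; have [adm zr zh _] := zetaP n w gw.
pose Psi (j : 'I_n) := psi (Z j w); pose Chi (j : 'I_n) := chi (Z j w).
have psiM : n%:R^-1 * \sum_j fnorm (Psi j) ^+ 2 <= M0 ^+ 2.
  apply: (le_trans hpsi); rewrite ler_pXn2r ?nnegrE//; rewrite /M0; lra.
have := el_expansion c0 (Wb n) Chi (A n) g1 Cbe (Tstar0 n w) M0_ge0 be_ge0
  (Tt n w) psiM adm zh.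
rewrite leNgt => /negP; apply; apply: le_lt_trans err.
apply: (@le_trans _ _ (del / Num.sqrt n%:R * K)); last first.
  by rewrite mulrAC ler_wpM2r// invr_ge0 ltW.
apply: (@el_rate_bound R m c be M0 (Num.sqrt n%:R) del (Tstar n w)
  (opnorm (S n w - W n)) _ _ (fnorm (Tbar n w)) (fnorm (zeta n w))) => //.
- by rewrite (ltW del0).
- by rewrite Tstar0.
- by rewrite opnorm_ge0.
- rewrite fnorm_ge0 /=; apply: le_trans hF.
  by rewrite le_eqVlt; apply/orP; left; apply/eqP; congr fnorm;
    rewrite /A -scalerBr -sumrB.
- apply: le_trans hX.
  rewrite le_eqVlt; apply/orP; left; apply/eqP; congr fnorm.
  by rewrite -scalemxAr mulmx_sumr -scalerBr -sumrB.
- by rewrite fnorm_ge0.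
- apply: (le_trans hTbar); rewrite ler_wpM2r ?invr_ge0 ?(ltW N0)// /M0; lra.
Unshelve. all: by end_near. Qed.
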